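(* Let $k \geq 2$ and $p_1 \geq p_2 \geq \cdots \geq p_k \geq 1$ be integers, let $G = K_{p_1,\ldots,p_k}$ be the complete multipartite graph with parts $V_i = \{x_{ij} : 1 \leq j \leq p_i\}$, $1 \leq i \leq k$, and let $J(G) \subset S = \mathbb{K}[x_{ij} : 1 \leq i \leq k,\ 1 \leq j \leq p_i]$ be its cover ideal, where $\mathbb{K}$ is a field. Then for all $s \geq 1$, $$\operatorname{reg}\left(J(G)^{(s)}\right) = s \cdot \deg(J(G)) + p_k - 1.$$
   Context: The complete multipartite graph $K_{p_1,\ldots,p_k}$ has vertex set the disjoint union $V_1 \cup \cdots \cup V_k$ with $|V_i| = p_i$, and its edges are all pairs $\{x,y\}$ with $x \in V_i$, $y \in V_j$, $i \neq j$. Vertices of a graph are identified with the variables of the standard graded polynomial ring $S$. The cover ideal of a graph $G$ is $J(G) = \left(\prod_{x \in w} x \mid w \text{ a minimal vertex cover of } G\right) \subset S$; equivalently $J(G) = \bigcap_{\{u,v\} \in E(G)} (u,v)$. Here $\deg(J(G)) = \max\{|C| : C \text{ is a minimal vertex cover of } G\}$. The $s$-th symbolic power of an ideal $I$ is $I^{(s)} = \bigcap_{\mathfrak{p} \in \operatorname{Ass}(S/I)} (I^s S_{\mathfrak{p}} \cap S)$; for a squarefree monomial ideal, $I^{(s)} = \bigcap_{\mathfrak{p} \in \operatorname{Ass}(S/I)} \mathfrak{p}^s$. For a finitely generated graded $S$-module $N$, $\operatorname{reg}(N) = \max\{j - i \mid \operatorname{Tor}_i^S(N,\mathbb{K})_j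 \neq 0\}$; $\operatorname{reg}(J(G)^{(s)})$ is the regularity of the ideal viewed as an $S$-module. *)

(* Defs.v *)
From HB Require Import structures.
From mathcomp Require Import all_boot all_order all_algebra.
From mathcomp Require Export mpoly.

Set Implicit Arguments.
Unset Strict Implicit.
Unset Printing Implicit Defensive.

Import GRing.Theory.
Local Open Scope ring_scope.

Section Ideals.
Variable R : comNzRingType.
Implicit Types (I P G : R -> Prop).

Definition is_ideal I : Prop :=
  [/\ I 0, (forall f g, I f -> I g -> I (f + g))
    & (forall f g, I g -> I (f * g))].

Definition prime_ideal P : Prop :=
  [/\ is_ideal P, ~ P 1 & forall f g, P (f * g) -> P f \/ P g].

Definition ideal_gen G : R -> Prop := fun f =>
  exists2 t : seq (R * R),
    (forall u, u \in t -> G u.2) & f = \sum_(u <- t) u.1 * u.2.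

Definition ideal_pow I (s : nat) : R -> Prop :=
  ideal_gen (fun f => exists2 t : s.-tuple R,
    (forall i, I (tnth t i)) & f = \prod_(i < s) tnth t i).

(* P \in Ass(R/I): P is a prime of the form (I : f). *)
Definition associated_prime I P : Prop :=
  prime_ideal P /\ exists f, forall g, P g <-> I (g * f).

(* f lies in the preimage of I^s R_P iff g * f \in I^s for some g \notin P. *)
Definition symbolic_pow I (s : nat) : R -> Prop := fun f =>
  forall P, associated_prime I P ->
    exists2 g, ~ P g & ideal_pow I s (g * f).

End Ideals.

Section Regularity.
Variables (K : fieldType) (n : nat).
Local Notation S := {mpoly K[n]}.

(* A sequence of finitely generated graded free S-modules
     ... -> F_2 -> F_1 -> F_0 -> S,
   F_i being the sum of the S(- gshift i a), a < grank i, acting on row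
   vectors: the a-th row of gdiff i is the image in F_i of the a-th basis
   element of F_(i+1), and gaug gives the images in S of the basis of F_0. *)
Record graded_free := GradedFree {
  grank : nat -> nat;
  gshift : forall i, 'I_(grank i) -> int;
  gdiff : forall i, 'M[S]_(grank i.+1, grank i);
  gaug : 'cV[S]_(grank 0)
}.

(* f is zero or homogeneous of degree d. *)
Definition homog_of_deg (d : int) (f : S) : Prop :=
  forall m, m \in msupp f -> (mdeg m)%:Z = d.

(* The maps have degree 0 and 0 <- I <- F_0 <- F_1 <- ... is exact. *)
Definition graded_free_resolution (F : graded_free) (I : S -> Prop) : Prop :=
  [/\ (forall i a b,
         homog_of_deg (gshift a - gshift b) (gdiff F i a b)),
      (forall a, homog_of_deg (gshift a) (gaug F a 0)),
      (forall f : S, I f <-> exists v : 'rV_(grank F 0), v *m gaug F = f%:M),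
      (forall v : 'rV_(grank F 0),
         v *m gaug F = 0 <-> exists w, v = w *m gdiff F 0)
    & (forall i (v : 'rV_(grank F i.+1)),
         v *m gdiff F i = 0 <-> exists w, v = w *m gdiff F i.+1)].

(* The differential of F (x)_S K, where K = S/(x_1, ..., x_n). *)
Definition tens_diff (F : graded_free) (i : nat) :
    'M[K]_(grank F i.+1, grank F i) :=
  map_mx (mcoeff 0%MM) (gdiff F i).

(* As K is concentrated in degree 0, (F_i (x) K)_j is spanned by the basis
   elements of F_i of degree j. *)
Definition tens_deg (F : graded_free) (i : nat) (j : int)
    (v : 'rV[K]_(grank F i)) : Prop :=
  forall a, v 0 a != 0 -> gshift a = j.

Definition tens_cycle (F : graded_free) (i : nat) :
    'rV[K]_(grank F i) -> Prop :=
  match i with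
  | 0 => fun=> True
  | i'.+1 => fun v => v *m tens_diff F i' = 0
  end.

Definition tens_boundary (F : graded_free) (i : nat) (j : int)
    (v : 'rV[K]_(grank F i)) : Prop :=
  exists2 w : 'rV[K]_(grank F i.+1), tens_deg j w & v = w *m tens_diff F i.

(* Tor_i^S(I, K)_j <> 0, i.e. H_i(F (x) K)_j <> 0 for a graded free resolution
   F of I; the homology does not depend on F. *)
Definition Tor_neq0 (I : S -> Prop) (i : nat) (j : int) : Prop :=
  exists2 F : graded_free, graded_free_resolution F I
    & exists v : 'rV[K]_(grank F i),
        [/\ tens_deg j v, tens_cycle v & ~ tens_boundary j v].

(* reg I = r, with I viewed as an S-module. *)
Definition has_reg (I : S -> Prop) (r : int) : Prop :=
  (exists i j, Tor_neq0 I i j /\ j - i%:Z = r) /\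
  (forall i j, Tor_neq0 I i j -> j - i%:Z <= r).

End Regularity.

Record sgraph := SGraph {
  vertex :> finType;
  edge : rel vertex;
  edge_sym : ssrbool.symmetric edge;
  edge_irrefl : irreflexive edge
}.

Section CoverIdeal.
Variable G : sgraph.

Definition vertex_cover (C : {set G}) : bool :=
  [forall x, forall y, edge x y ==> (x \in C) || (y \in C)].

Definition min_vertex_cover (C : {set G}) : bool := minset vertex_cover C.

(* The vertex x is identified with the variable of index enum_rank x. *)
Definition cover_ideal (K : fieldType) : {mpoly K[#|G|]} -> Prop :=
  ideal_gen (fun f => exists2 C : {set G},
    min_vertex_cover C & f = \prod_(x in C) 'X_(enum_rank x)).

Definition cover_ideal_deg : nat :=
  \max_(C : {set G} | min_vertex_cover C) #|C|.

End CoverIdeal.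

Section CompleteMultipartite.
Variables (k : nat) (p : k.-tuple nat).

(* The vertex x_ij is the pair of i : 'I_k and j : 'I_(p_i). *)
Definition multipartite_vertex : finType := {i : 'I_k & 'I_(tnth p i)}.

Definition multipartite_edge : rel multipartite_vertex :=
  fun x y => tag x != tag y.

Lemma multipartite_edge_sym : ssrbool.symmetric multipartite_edge.
Proof. by move=> x y; rewrite /multipartite_edge eq_sym. Qed.

Lemma multipartite_edge_irrefl : irreflexive multipartite_edge.
Proof. by move=> x; rewrite /multipartite_edge eqxx. Qed.

Definition complete_multipartite : sgraph :=
  SGraph multipartite_edge_sym multipartite_edge_irrefl.

End CompleteMultipartite.

(* Main.v *)
(** Monomials of the symbolic power J^(s) are those m with m_x + m_y >= s for
    every edge xy, since J is the intersection of the primes (x, y). Only the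
    minimal exponent on each part matters, so J^(s) is generated by k chains of
    monomials with exponent t on one part and s - t on the others, t < s/2, each
    chain ending in a common root, the product of all vertices to the power s/2
    rounded up (redundant if s is odd). Ordered from the root outwards, each generator
    u has a colon ideal (previous generators : u) that is principal, generated by
    the product of the vertices of its distinguished part V_i, and the
    corresponding syzygy involves only u and its neighbour towards the root. This
    gives a graded free resolution of length one. The generator with t = 0 on the
    smallest part has a syzygy of degree s (|V| - p_k) + p_k, and this syzygy
    attains the regularity. Tor computed from any other
    resolution is compared with this one by homogeneous chain maps and a
    homotopy. *)

Require Import Defs.
From mathcomp Require Import all_boot all_order all_algebra.
From mathcomp Require Import zify ring.

Import GRing.Theory.
Local Open Scope ring_scope.

Set Implicit Arguments.
Unset Strict Implicit.
Unset Printing Implicit Defensive.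

(** * Comparison of graded free resolutions *)

Section Homogeneous.
Variables (K : fieldType) (n : nat).
Local Notation S := {mpoly K[n]}.
Implicit Types (d e : int) (f g : S).

Lemma homog0 d : homog_of_deg d (0 : S).
Proof. by move=> m; rewrite msupp0. Qed.

Lemma homogX m : homog_of_deg (mdeg m)%:Z ('X_[m] : S).
Proof. by move=> m'; rewrite msuppX inE => /eqP ->. Qed.

Lemma homogN d f : homog_of_deg d f -> homog_of_deg d (- f).
Proof. by move=> hf m; rewrite (perm_mem (msuppN f)); apply: hf. Qed.

Lemma homogD d f g :
  homog_of_deg d f -> homog_of_deg d g -> homog_of_deg d (f + g).
Proof.
move=> hf hg m /msuppD_le; rewrite mem_cat.
by case/orP; [apply: hf | apply: hg].
Qed.

Lemma homogM d e f g :
  homog_of_deg d f -> homog_of_deg e g -> homog_of_deg (d + e) (f * g).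
Proof.
move=> hf hg m /msuppM_le /allpairsP[[m1 m2] /= [/hf <- /hg <- ->]].
by rewrite mdegD.
Qed.

Lemma homog_sum d (I : finType) (F : I -> S) :
  (forall i, homog_of_deg d (F i)) -> homog_of_deg d (\sum_i F i).
Proof.
by move=> hF; elim/big_ind: _ => [|f g|i _]; [apply: homog0 | apply: homogD |].
Qed.

(** Component of degree d; the degree is an integer because differences of shifts, possibly
    negative, are used. *)
Definition hpart d f : S :=
  \sum_(m <- msupp f | (mdeg m)%:Z == d) f@_m *: 'X_[m].

Lemma mcoeff_hpart d f m :
  (hpart d f)@_m = if (mdeg m)%:Z == d then f@_m else 0.
Proof.
rewrite /hpart raddf_sum /= big_mkcond /=.
under eq_bigr => m' _.
  have -> : (if (mdeg m')%:Z == d then (f@_m' *: 'X_[m'])@_m else 0)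
    = if m' == m then (if (mdeg m)%:Z == d then f@_m else 0) else 0.
    rewrite mcoeffZ mcoeffX; case: (m' =P m) => [->|_]; first by rewrite mulr1.
    by rewrite mulr0 if_same.
  over.
rewrite -big_mkcond /=; have [hm|hm] := boolP (m \in msupp f).
  by rewrite -big_filter filter_pred1_uniq ?big_seq1 ?msupp_uniq.
rewrite memN_msupp_eq0 // if_same big1 //.
Qed.

Lemma hpart_homog d f : homog_of_deg d (hpart d f).
Proof.
by move=> m; rewrite mcoeff_msupp mcoeff_hpart; case: ifP => [/eqP //|_ /eqP].
Qed.

Lemma hpart_id d f : homog_of_deg d f -> hpart d f = f.
Proof.
move=> hf; apply/mpolyP=> m; rewrite mcoeff_hpart; case: eqP => // hm.
by apply/esym/memN_msupp_eq0/negP => /hf.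
Qed.

Lemma hpart_sum d (I : finType) (F : I -> S) :
  hpart d (\sum_i F i) = \sum_i hpart d (F i).
Proof.
apply/mpolyP=> m; rewrite mcoeff_hpart [RHS]raddf_sum.
case: ifP => hd; first rewrite raddf_sum; last rewrite big1 //; last first.
  by move=> i _; rewrite /= mcoeff_hpart hd.
by apply: eq_bigr => i _; rewrite /= mcoeff_hpart hd.
Qed.

Lemma hpartM d e f g :
  homog_of_deg e g -> hpart d (f * g) = hpart (d - e) f * g.
Proof.
move=> hg; apply/mpolyP=> m; rewrite mcoeff_hpart !mcoeffM.
have E (k : 'X_{1..n < (mdeg m).+1, (mdeg m).+1}) : m == (k.1 + k.2)%MM ->
    (hpart (d - e) f)@_k.1 * g@_k.2
    = if (mdeg m)%:Z == d then f@_k.1 * g@_k.2 else 0.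
  move=> /eqP hk; rewrite mcoeff_hpart.
  have [hk2|] := boolP (val k.2 \in msupp g); last first.
    by move/memN_msupp_eq0=> ->; rewrite !mulr0 if_same.
  have -> : ((mdeg m)%:Z == d) = ((mdeg k.1)%:Z == d - e).
    move: (congr1 mdeg hk) (hg _ hk2 : (mdeg k.2)%:Z = e); rewrite mdegD.
    by move: (mdeg m) (mdeg k.1) (mdeg k.2) => a b c; lia.
  by case: ifP; rewrite ?mul0r.
case: ifP => hd; last rewrite big1 //; last first.
  by move=> k hk; rewrite E // hd.
by apply: eq_bigr => k hk; rewrite E // hd.
Qed.

(** Matrix of a degree 0 map of graded free modules with basis degrees [sa] and [sb], acting on row
    vectors. *)
Definition hmatrix (a b : nat) (sa : 'I_a -> int) (sb : 'I_b -> int)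
  (M : 'M[S]_(a, b)) := forall i j, homog_of_deg (sa i - sb j) (M i j).

Lemma hmatrixM a b c (sa : 'I_a -> int) (sb : 'I_b -> int) (sc : 'I_c -> int)
    (M : 'M[S]_(a, b)) (N : 'M[S]_(b, c)) :
  hmatrix sa sb M -> hmatrix sb sc N -> hmatrix sa sc (M *m N).
Proof.
move=> hM hN i j; rewrite mxE; apply: homog_sum => l.
by rewrite -[sa i](subrK (sb l)) -addrA; apply: homogM.
Qed.

Lemma hmatrixB a b (sa : 'I_a -> int) (sb : 'I_b -> int) (M N : 'M[S]_(a, b)) :
  hmatrix sa sb M -> hmatrix sa sb N -> hmatrix sa sb (M - N).
Proof. by move=> hM hN i j; rewrite !mxE; apply/homogD/homogN. Qed.

Lemma hmatrix1 a (sa : 'I_a -> int) : hmatrix sa sa 1%:M.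
Proof.
move=> i j; rewrite mxE; case: (i =P j) => [->|_]; last exact: homog0.
rewrite subrr mulr1n -mpolyX0 => m; rewrite msuppX inE => /eqP ->.
by rewrite mdeg0.
Qed.

(** Row-wise preimages need not be homogeneous. As D and M are, replacing each coefficient by its
    component of the required degree keeps the product. *)
Lemma hmatrix_lift a b c (sa : 'I_a -> int) (sb : 'I_b -> int)
    (sc : 'I_c -> int) (D : 'M[S]_(b, c)) (M : 'M[S]_(a, c)) :
  hmatrix sb sc D -> hmatrix sa sc M ->
  (forall i, exists w : 'rV_b, row i M = w *m D) ->
  exists2 N, hmatrix sa sb N & M = N *m D.
Proof.
move=> hD hM /fin_all_exists[w hw].
exists (\matrix_(i, j) hpart (sa i - sb j) (w i 0 j)).
  by move=> i j; rewrite mxE; apply: hpart_homog.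
apply/matrixP=> i l; rewrite -(hpart_id (hM i l)).
move/rowP/(_ l): (hw i); rewrite !mxE => ->; rewrite hpart_sum.
apply: eq_bigr => j _; rewrite !mxE (hpartM _ _ (hD j l)).
by congr (hpart _ _ * _); ring.
Qed.

(** An entry of a degree 0 matrix has a constant term only between basis elements of equal degree,
    so reduction modulo the variables respects the grading. *)
Lemma mx_const_deg a b (sa : 'I_a -> int) (sb : 'I_b -> int) M j
    (v : 'rV[K]_a) :
  hmatrix sa sb M -> (forall i, v 0 i != 0 -> sa i = j) ->
  forall l, (v *m map_mx (mcoeff 0%MM) M) 0 l != 0 -> sb l = j.
Proof.
move=> hM hv l; apply: contraNeq => hl; rewrite mxE big1 // => i _.
rewrite mxE; have [-> | /hv hi] := eqVneq (v 0 i) 0; first by rewrite mul0r.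
rewrite [X in _ * X]memN_msupp_eq0 ?mulr0 //; apply/negP => /hM.
by rewrite mdeg0 hi => /eqP; rewrite eq_sym subr_eq0 eq_sym (negPf hl).
Qed.

Implicit Type F E : graded_free K n.

Lemma lift_gaug F I a (sa : 'I_a -> int) (M : 'cV[S]_a) :
  graded_free_resolution F I ->
  (forall i, homog_of_deg (sa i) (M i 0)) -> (forall i, I (M i 0)) ->
  exists2 N, hmatrix sa (@gshift _ _ F 0) N & M = N *m gaug F.
Proof.
case=> _ haug hI _ _ hM hMI.
apply: (@hmatrix_lift _ _ _ _ _ (fun=> 0)) => [i j|i j|i].
- by rewrite ord1 subr0.
- by rewrite ord1 subr0.
have /hI[v hv] := hMI i; exists v; rewrite hv.
by apply/rowP=> j; rewrite ord1 !mxE eqxx mulr1n.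
Qed.

Lemma lift_gdiff0 F I a (sa : 'I_a -> int) (M : 'M[S]_(a, _)) :
  graded_free_resolution F I -> hmatrix sa (@gshift _ _ F 0) M ->
  M *m gaug F = 0 ->
  exists2 N, hmatrix sa (@gshift _ _ F 1) N & M = N *m gdiff F 0.
Proof.
case=> hd _ _ h0 _ hM hM0; apply: hmatrix_lift hM _ => [i j|i]; first exact: hd.
by apply/h0; rewrite -row_mul hM0 row0.
Qed.

Lemma lift_gdiffS F I i a (sa : 'I_a -> int) (M : 'M[S]_(a, _)) :
  graded_free_resolution F I -> hmatrix sa (@gshift _ _ F i.+1) M ->
  M *m gdiff F i = 0 ->
  exists2 N, hmatrix sa (@gshift _ _ F i.+2) N & M = N *m gdiff F i.+1.
Proof.
case=> hd _ _ _ hS hM hM0; apply: hmatrix_lift hM _ => [j l|j]; first exact: hd.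
by apply/hS; rewrite -row_mul hM0 row0.
Qed.

Lemma gdiff_gaug F I : graded_free_resolution F I -> gdiff F 0 *m gaug F = 0.
Proof.
case=> _ _ _ h0 _; apply/row_matrixP=> i; rewrite row_mul row0.
by apply/h0; exists (delta_mx 0 i); rewrite -rowE.
Qed.

Lemma gdiff_gdiff F I i :
  graded_free_resolution F I -> gdiff F i.+1 *m gdiff F i = 0.
Proof.
case=> _ _ _ _ hS; apply/row_matrixP=> j; rewrite row_mul row0.
by apply/hS; exists (delta_mx 0 j); rewrite -rowE.
Qed.

Lemma gaug_ideal F I i : graded_free_resolution F I -> I (gaug F i 0).
Proof.
case=> _ _ hI _ _; apply/hI; exists (delta_mx 0 i); rewrite -rowE.
by apply/rowP=> j; rewrite ord1 !mxE eqxx mulr1n.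
Qed.

(* [A] and [B] are the components in homological degree [i] of chain maps
   F -> E -> F over I, and [H] that of a homotopy from their composite to the
   identity; only what is needed to extend them to degree [i.+1] is kept. *)
Definition comparison F E i (A : 'M[S]_(grank F i, grank E i))
    (B : 'M[S]_(grank E i, grank F i)) (H : 'M[S]_(grank F i, grank F i.+1)) :=
  [/\ [/\ hmatrix (@gshift _ _ F i) (@gshift _ _ E i) A,
        hmatrix (@gshift _ _ E i) (@gshift _ _ F i) B
        & hmatrix (@gshift _ _ F i) (@gshift _ _ F i.+1) H],
    exists2 A', hmatrix (@gshift _ _ F i.+1) (@gshift _ _ E i.+1) A'
      & gdiff F i *m A = A' *m gdiff E i,
    exists2 B', hmatrix (@gshift _ _ E i.+1) (@gshift _ _ F i.+1) B'
      & gdiff E i *m B = B' *m gdiff F i,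
    gdiff F i *m (1%:M - A *m B) = gdiff F i *m (H *m gdiff F i)
  & forall v : 'rV[K]_(grank F i), tens_cycle v ->
      tens_cycle (v *m map_mx (mcoeff 0%MM) A) /\
      v = v *m map_mx (mcoeff 0%MM) A *m map_mx (mcoeff 0%MM) B
          + v *m map_mx (mcoeff 0%MM) H *m tens_diff F i].

Lemma comparison_exists F E I i :
  graded_free_resolution F I -> graded_free_resolution E I ->
  exists A B H, @comparison F E i A B H.
Proof.
move=> rF rE.
have hdF j : hmatrix (@gshift _ _ F j.+1) (@gshift _ _ F j) (gdiff F j).
  by case: rF => + _ _ _ _; apply.
have hdE j : hmatrix (@gshift _ _ E j.+1) (@gshift _ _ E j) (gdiff E j).
  by case: rE => + _ _ _ _; apply.
elim: i => [|i [A [B [H [[hA hB hH] [A' hA' eA] [B' hB' eB] eH _]]]]].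
  have [||A hA eA] := @lift_gaug E I _ (@gshift _ _ F 0) (gaug F) rE.
  - by case: rF.
  - by move=> i; apply: gaug_ideal.
  have [||B hB eB] := @lift_gaug F I _ (@gshift _ _ E 0) (gaug E) rF.
  - by case: rE.
  - by move=> i; apply: gaug_ideal.
  have [||H hH eH] := @lift_gdiff0 F I _ (@gshift _ _ F 0) (1%:M - A *m B) rF.
  - by apply: hmatrixB; [apply: hmatrix1 | apply: hmatrixM hA hB].
  - by rewrite mulmxBl mul1mx -mulmxA -eB -eA subrr.
  exists A, B, H; split=> //.
  - apply: (lift_gdiff0 rE); first exact: hmatrixM (hdF _) hA.
    by rewrite -mulmxA -eA (gdiff_gaug rF).
  - apply: (lift_gdiff0 rF); first exact: hmatrixM (hdE _) hB.
    by rewrite -mulmxA -eB (gdiff_gaug rE).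
  - by rewrite eH.
  move=> v _; split=> //; rewrite -!mulmxA -mulmxDr -!map_mxM -map_mxD -eH.
  by rewrite addrC subrK map_mx1 mulmx1.
(* The invariant on H makes this matrix vanish after [gdiff F i], so it factors through the next
   differential; the factor is the next homotopy. *)
have [||H' hH' eH'] := @lift_gdiffS F I i _ (@gshift _ _ F i.+1)
  (1%:M - A' *m B' - gdiff F i *m H) rF.
- apply: hmatrixB; last exact: hmatrixM (hdF _) hH.
  by apply: hmatrixB; [apply: hmatrix1 | apply: hmatrixM hA' hB'].
- rewrite !mulmxBl mul1mx -mulmxA -eB -mulmxA -eH mulmxA -eA mulmxBr mulmx1.
  by rewrite mulmxA subrr.
exists A', B', H'; split=> //.
- apply: (lift_gdiffS rE); first exact: hmatrixM (hdF _) hA'.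
  by rewrite -mulmxA -eA mulmxA (gdiff_gdiff _ rF) mul0mx.
- apply: (lift_gdiffS rF); first exact: hmatrixM (hdE _) hB'.
  by rewrite -mulmxA -eB mulmxA (gdiff_gdiff _ rE) mul0mx.
- by rewrite -eH' [in RHS]mulmxBr [in RHS]mulmxA (gdiff_gdiff _ rF) mul0mx subr0.
move=> v hv; split.
  by rewrite /= /tens_diff -mulmxA -map_mxM -eA map_mxM mulmxA hv mul0mx.
rewrite -!mulmxA -mulmxDr -!map_mxM -map_mxD -eH'.
have -> : A' *m B' + (1%:M - A' *m B' - gdiff F i *m H)
  = 1%:M - gdiff F i *m H by rewrite addrAC addrC addNKr.
by rewrite map_mxB map_mx1 mulmxBr mulmx1 map_mxM mulmxA hv mul0mx subr0.
Qed.

(** Homology classes are carried from F to E by A. If the image were a boundary, B' and the homotopy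
    would make the original class one too. Upper bounds on Tor can thus be read off from one
    resolution. *)
Lemma Tor_neq0_resolution E I i j :
  graded_free_resolution E I -> Tor_neq0 I i j ->
  exists v : 'rV[K]_(grank E i),
    [/\ tens_deg j v, tens_cycle v & ~ tens_boundary j v].
Proof.
move=> rE [F rF [v [dv cv nbv]]].
have [A [B [H [[hA hB hH] [A' hA' eA] [B' hB' eB] eH hv]]]] :=
  comparison_exists i rF rE.
have [cA ev] := hv v cv; exists (v *m map_mx (mcoeff 0%MM) A); split=> //.
  exact: mx_const_deg hA dv.
case=> w dw ew; apply: nbv.
exists (w *m map_mx (mcoeff 0%MM) B' + v *m map_mx (mcoeff 0%MM) H).
  have dwB := mx_const_deg hB' dw; have dvH := mx_const_deg hH dv.
  move=> l; rewrite mxE; case: eqP (dwB l) (dvH l) => [-> _|_ -> //].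
  by rewrite add0r.
rewrite mulmxDl {1}ev ew -mulmxA -map_mxM eB.
by rewrite map_mxM mulmxA.
Qed.

End Homogeneous.

(** * Resolutions of length one with tree-shaped syzygies *)

Section TreeResolution.
Variables (R : idomainType) (N : nat) (u : 'I_N.+1 -> R) (c d : 'I_N -> R).
Variable par : 'I_N -> 'I_N.+1.

(** Row q encodes an edge of a tree with root 0, in which node q+1 has parent [par q]. *)
Definition tree_diff : 'M[R]_(N, N.+1) :=
  \matrix_(q, r) (c q *+ (r == q.+1 :> nat) - d q *+ (r == par q :> nat)).

Definition tree_aug : 'cV[R]_N.+1 := \col_r u r.

Hypothesis u0_neq0 : u ord0 != 0.
Hypothesis c_neq0 : forall q, c q != 0.
Hypothesis par_le : forall q, (par q <= q)%N.
Hypothesis tree_rel : forall q : 'I_N, c q * u (lift ord0 q) = d q * u (par q).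
Hypothesis tree_colon : forall (q : 'I_N) f (w : 'I_N.+1 -> R),
  f * u (lift ord0 q) = \sum_(r < N.+1 | (r <= q)%N) w r * u r ->
  exists g, f = g * c q.

Lemma tree_complex : tree_diff *m tree_aug = 0.
Proof.
apply/colP=> q; rewrite !mxE.
under eq_bigr => r _ do
  rewrite !mxE -(lift0 q) !(inj_eq val_inj) mulrBl !mulrnAl !mulrb.
rewrite sumrB -!big_mkcond /= !big_pred1_eq.
by rewrite tree_rel subrr.
Qed.

(** Column q+1 has [c q] in row q; its other entries lie in rows of children of q+1, which have
    larger index. So the coefficients of w vanish from the last one down. *)
Lemma tree_diff_inj (w : 'rV_N) : w *m tree_diff = 0 -> w = 0.
Proof.
move=> hw; suff H m : forall q : 'I_N, (N <= q + m)%N -> w 0 q = 0.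
  by apply/rowP=> q; rewrite mxE (H N) ?leq_addl.
elim: m => [|m IH] q hq; first by rewrite addn0 leqNgt ltn_ord in hq.
move/rowP/(_ (lift ord0 q)): hw; rewrite !mxE (bigD1 q) //= big1 => [|q' hq'].
  rewrite addr0 mxE (lift0 q) eqxx.
  have := par_le q; case: eqP => [<-|_ _]; first by rewrite ltnn.
  by rewrite subr0 => /eqP; rewrite mulf_eq0 (negPf (c_neq0 q)) orbF => /eqP.
rewrite mxE lift0 eqSS eq_sym [(_ == _ :> nat)](negPf hq') sub0r.
case: eqP => [e|_]; last by rewrite oppr0 mulr0.
by rewrite IH ?mul0r // (leq_trans hq) // addnS -addSn leq_add2r e par_le.
Qed.

(** Elimination from the top: the leading coefficient of a syzygy lies in the colon ideal of the
    earlier generators, hence is a multiple of [c q], and subtracting that multiple of row q lowers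
    the leading index. At index 0, [u ord0] is a nonzerodivisor. *)
Lemma tree_exact (v : 'rV_N.+1) :
  v *m tree_aug = 0 <-> exists w, v = w *m tree_diff.
Proof.
split=> [hv|[w ->]]; last by rewrite -mulmxA tree_complex mulmx0.
suff H m : (m <= N)%N -> forall v : 'rV_N.+1, v *m tree_aug = 0 ->
    (forall r : 'I_N.+1, (m < r)%N -> v 0 r = 0) ->
    exists w, v = w *m tree_diff.
  by apply: (H N) => // r; rewrite ltnNge -ltnS ltn_ord.
elim: m {v hv} => [_|m IH hm] v hv hr.
  exists 0; rewrite mul0mx; apply/rowP=> r; rewrite mxE.
  case: (unliftP ord0 r) => [q ->|->]; first by apply: hr.
  move/rowP/(_ 0): hv; rewrite !mxE big_ord_recl big1 => [|q _].
    rewrite addr0 mxE => /eqP; rewrite mulf_eq0 (negPf u0_neq0) orbF.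
    by move/eqP.
  by rewrite hr ?mul0r.
pose q := Ordinal hm.
have [g hg] : exists g, v 0 (lift ord0 q) = g * c q.
  apply: (tree_colon (w := fun r => - v 0 r)).
  move/rowP/(_ 0): hv; rewrite !mxE (bigD1 (lift ord0 q)) //= mxE.
  move/eqP; rewrite addr_eq0 => /eqP ->; rewrite -sumrN.
  rewrite [LHS]big_mkcond [RHS]big_mkcond; apply: eq_bigr => r _.
  rewrite mxE mulNr -(inj_eq val_inj) [val (lift _ _)]lift0.
  have [h|h|->] := ltngtP r m.+1.
  - by rewrite -ltnS h.
  - by rewrite hr ?mul0r ?oppr0 ?if_same.
  by rewrite ltnn.
have [||w hw] := IH (ltnW hm) (v - g *: row q tree_diff).
- rewrite mulmxBl hv -scalemxAl -row_mul tree_complex.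
  by rewrite row0 scaler0 subrr.
- move=> r hrm; rewrite !mxE.
  have -> : (r == par q :> nat) = false.
    by apply/eqP=> e; have := par_le q; rewrite -e /=; lia.
  rewrite subr0; have [->|ne] := eqVneq r (lift ord0 q).
    by rewrite lift0 eqxx hg subrr.
  rewrite -(inj_eq val_inj) [val (lift _ _)]lift0 in ne.
  rewrite (negPf ne) mulr0 subr0 hr //.
  by rewrite ltn_neqAle eq_sym ne.
exists (w + g *: delta_mx 0 q).
by rewrite mulmxDl -scalemxAl -rowE -hw subrK.
Qed.

End TreeResolution.

(** * Symbolic powers of cover ideals *)

(** In coefficient d of the product, all terms but p_0 q_d involve lower coefficients of q, and p_0
    cancels. *)
Lemma poly_low_coef (R : idomainType) (p q : {poly R}) s :
  p`_0 != 0 -> (forall d, (d < s)%N -> (p * q)`_d = 0) ->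
  forall d, (d < s)%N -> q`_d = 0.
Proof.
move=> p0 hpq; elim/ltn_ind=> d IH hd; have := hpq d hd; rewrite coefM.
rewrite big_ord_recl big1 => [|i _]; last first.
  have hi : (d - lift ord0 i < d)%N.
    by rewrite lift0 -subn_gt0 subKn // ltn_ord.
  by rewrite IH ?mulr0 // (ltn_trans hi).
by rewrite addr0 subn0 => /eqP; rewrite mulf_eq0 (negPf p0) => /eqP.
Qed.

(** * Powers of primes generated by variables *)

Section Order.
Variables (K : fieldType) (n : nat) (A : {set 'I_n}).
Local Notation S := {mpoly K[n]}.
Implicit Types (f g : S) (m : 'X_{1..n}).

Definition wt m := (\sum_(z in A) m z)%N.

(* [f] lies in the [s]-th power of the prime generated by the variables in A. *)
Definition ord_ge (s : nat) f : bool := all (fun m => s <= wt m)%N (msupp f).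

Lemma ord_geP s f :
  reflect (forall m, m \in msupp f -> (s <= wt m)%N) (ord_ge s f).
Proof. exact: allP. Qed.

Lemma wtD m1 m2 : wt (m1 + m2) = (wt m1 + wt m2)%N.
Proof. by rewrite /wt -big_split; apply: eq_bigr => z _; rewrite mnmDE. Qed.

Lemma ord_ge0 s : ord_ge s 0.
Proof. by rewrite /ord_ge msupp0. Qed.

Lemma ord_geX s m : ord_ge s ('X_[m] : S) = (s <= wt m)%N.
Proof. by rewrite /ord_ge msuppX /= andbT. Qed.

Lemma ord_geD s f g : ord_ge s f -> ord_ge s g -> ord_ge s (f + g).
Proof.
move=> /ord_geP hf /ord_geP hg; apply/ord_geP=> m /msuppD_le.
by rewrite mem_cat => /orP[/hf|/hg].
Qed.

Lemma ord_ge_sum s (I : eqType) (r : seq I) (F : I -> S) :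
  (forall i, i \in r -> ord_ge s (F i)) -> ord_ge s (\sum_(i <- r) F i).
Proof.
move=> hF; rewrite big_seq; elim/big_rec: _ => [|i f hi]; first exact: ord_ge0.
exact/ord_geD/hF.
Qed.

Lemma ord_geM s t f g : ord_ge s f -> ord_ge t g -> ord_ge (s + t) (f * g).
Proof.
move=> /ord_geP hf /ord_geP hg; apply/ord_geP=> m.
move=> /msuppM_le /allpairsP[[m1 m2] /= [/hf h1 /hg h2 ->]].
by rewrite wtD leq_add.
Qed.

Lemma ord_ge_triv f : ord_ge 0 f.
Proof. exact/allP. Qed.

Lemma ord_ge_mull s f g : ord_ge s g -> ord_ge s (f * g).
Proof. by move=> hg; rewrite -[s]add0n ord_geM ?ord_ge_triv. Qed.

Lemma ord_ge_prod s (F : 'I_s -> S) :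
  (forall i, ord_ge 1 (F i)) -> ord_ge s (\prod_i F i).
Proof.
elim: s F => [|s IH] F hF; first exact: ord_ge_triv.
by rewrite big_ord_recl; apply: (@ord_geM 1 s); [apply: hF | apply: IH].
Qed.

(* X_z |-> X_z T for z in A: the T-adic order of the image is the A-order. *)
Definition homogenize : S -> {poly S} :=
  mmap (polyC \o @mpolyC n K)
    (fun z => if z \in A then ('X_z)%:P * 'X else ('X_z)%:P).

Lemma coef_homogenize f d m :
  ((homogenize f)`_d)@_m = if wt m == d then f@_m else 0.
Proof.
have hX m' : mmap1 (fun z => if z \in A then ('X_z)%:P * 'X else ('X_z)%:P) m'
    = ('X_[m'] : S)%:P * 'X^(wt m').
  rewrite /mmap1 /wt mpolyXE_id rmorph_prod /= -prodrXr [X in _ * X]big_mkcond /=.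
  rewrite -big_split /=; apply: eq_bigr => z _; rewrite rmorphXn /=.
  by case: (z \in A); rewrite ?mulr1 // exprMn_comm //; apply: commr_polyX.
rewrite /homogenize /mmap coef_sum raddf_sum /=.
rewrite (eq_bigr (fun m' => (f@_m' * ((wt m' == d) && (m' == m))%:R))); last first.
  move=> m' _; rewrite hX /= mulrA -polyCM coefCM coefXn -mulrA mcoeffCM.
  rewrite eq_sym; case: (wt m' == d); last by rewrite !mulr0 mcoeff0 mulr0.
  by rewrite mulr1 mcoeffX.
have [hm|hm] := boolP (m \in msupp f); last first.
  rewrite big1_seq => [|m' /andP[_ hm']].
    by rewrite memN_msupp_eq0 //; case: ifP.
  by case: (m' =P m) => [e|_]; [rewrite -e hm' in hm | rewrite andbF mulr0].
rewrite (bigD1_seq m) //= big1 => [|m' /negPf ->]; last by rewrite andbF mulr0.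
by rewrite eqxx andbT addr0; case: eqP; rewrite ?mulr1 ?mulr0.
Qed.

Lemma homogenizeM f g : homogenize (f * g) = homogenize f * homogenize g.
Proof. exact: rmorphM. Qed.

Lemma ord_ge_homogenize s f :
  ord_ge s f <-> forall d, (d < s)%N -> (homogenize f)`_d = 0.
Proof.
split=> [/ord_geP hf d hd|h].
  apply/mpolyP=> m; rewrite coef_homogenize mcoeff0; case: eqP => // hm.
  by apply: memN_msupp_eq0; apply: contraTN hd => /hf; rewrite hm -leqNgt.
apply/ord_geP=> m; rewrite mcoeff_msupp leqNgt; apply: contraNN => /h.
by move/(congr1 (mcoeff m)); rewrite coef_homogenize eqxx mcoeff0 => ->.
Qed.

(** Powers of the prime P generated by A are P-primary: for g outside P the image of g in S[T] has
    nonzero constant term in T, so multiplying by it does not raise the T-adic order. *)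
Lemma ord_ge_prime s f g : ~~ ord_ge 1 g -> ord_ge s (g * f) -> ord_ge s f.
Proof.
move=> hg /ord_ge_homogenize hgf; apply/ord_ge_homogenize.
have g0 : (homogenize g)`_0 != 0.
  apply: contraNneq hg => hg0; apply/ord_ge_homogenize=> d.
  by rewrite ltnS leqn0 => /eqP ->.
by apply: (poly_low_coef g0) => d hd; rewrite -homogenizeM hgf.
Qed.

End Order.

Section IdealGen.
Variable R : comNzRingType.
Implicit Type I : R -> Prop.

Lemma ideal_gen_mull (G : R -> Prop) f g : G g -> ideal_gen G (f * g).
Proof.
move=> hg; exists [:: (f, g)]; last by rewrite big_seq1.
by move=> u; rewrite inE => /eqP ->.
Qed.

Lemma ideal_gen_sum (G : R -> Prop) (J : eqType) (r : seq J) (F : J -> R) :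
  (forall i, i \in r -> ideal_gen G (F i)) -> ideal_gen G (\sum_(i <- r) F i).
Proof.
elim: r => [|i r IH] hF; first by exists [::]; rewrite ?big_nil.
have [|t ht e] := IH; first by move=> j hj; apply: hF; rewrite inE hj orbT.
have [t' ht' e'] := hF i (mem_head _ _); exists (t' ++ t).
  by move=> v; rewrite mem_cat => /orP[/ht'|/ht].
by rewrite big_cons big_cat e e'.
Qed.

Lemma ideal_gen_mulr_closed (G : R -> Prop) f g :
  ideal_gen G g -> ideal_gen G (f * g).
Proof.
case=> t ht ->; rewrite big_distrr /=; apply: ideal_gen_sum => u hu.
by rewrite mulrA; apply/ideal_gen_mull/ht.
Qed.

Lemma ideal_pow_expM I a b s i : I a -> I b -> (i <= s)%N ->
  ideal_pow I s (a ^+ i * b ^+ (s - i)).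
Proof.
move=> ha hb hi; rewrite -[_ * _]mul1r; apply: ideal_gen_mull.
exists [tuple if (j < i)%N then a else b | j < s].
  by move=> j; rewrite tnth_mktuple; case: ifP.
under eq_bigr => j _ do rewrite tnth_mktuple.
rewrite -(big_mkord xpredT (fun j => if (j < i)%N then a else b)).
rewrite (big_cat_nat (leq0n i) hi) /=; congr (_ * _).
  rewrite (eq_big_nat _ _ (F2 := fun=> a)) => [|j /andP[_ ->] //].
  by rewrite prodr_const_nat subn0.
rewrite (eq_big_nat _ _ (F2 := fun=> b)) => [|j /andP[]].
  by rewrite prodr_const_nat.
by rewrite leqNgt => /negPf ->.
Qed.

End IdealGen.

(** * Cover ideals and edge primes *)

Section CoverIdealSymbolicPower.
Variables (G : sgraph) (K : fieldType).
Local Notation n := #|G|.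
Local Notation S := {mpoly K[n]}.
Local Notation J := (cover_ideal (G := G) (K := K)).
Implicit Types (f g : S) (x y : G).

Definition edge_prime x y : {set 'I_n} := [set enum_rank x; enum_rank y].

Lemma wt_edge x y m : edge x y ->
  wt (edge_prime x y) m = (m (enum_rank x) + m (enum_rank y))%N.
Proof.
move=> hxy; rewrite /wt big_setU1 ?big_set1 // inE (inj_eq enum_rank_inj).
by apply: contraTneq hxy => ->; rewrite edge_irrefl.
Qed.

Definition cover_mon (C : {set G}) : 'X_{1..n} :=
  [multinom (enum_val z \in C : nat) | z < n].

Lemma cover_monE (C : {set G}) :
  \prod_(x in C) 'X_(enum_rank x) = 'X_[cover_mon C] :> S.
Proof.
rewrite mpolyXE_id big_mkcond [RHS](reindex (@enum_rank G)) /=; last first.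
  exact/onW_bij/enum_rank_bij.
apply: eq_bigr => x _.
by rewrite mnmE enum_rankK; case: (x \in C).
Qed.

(** Every cover meets every edge. Conversely, the support of each monomial of f is a vertex cover,
    and the monomial of a minimal cover inside it divides the given one. *)
Lemma cover_idealP f :
  J f <-> forall x y, edge x y -> ord_ge (edge_prime x y) 1 f.
Proof.
split=> [[t ht -> x y hxy]|h].
  apply: ord_ge_sum => u /ht[C /minsetp /forallP/(_ x)/forallP/(_ y)].
  rewrite hxy cover_monE => hC ->; rewrite ord_ge_mull // ord_geX wt_edge //.
  by rewrite !mnmE !enum_rankK; move: hC => /=; do 2!case: (_ \in C).
rewrite [f]mpolyE; apply: ideal_gen_sum => m hm.
have /minset_exists[C hC sC] : vertex_cover [set x | 0 < m (enum_rank x)]%N.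
  apply/forallP=> x; apply/forallP=> y; apply/implyP=> hxy.
  have /ord_geP/(_ m hm) := h x y hxy.
  by rewrite wt_edge // addn_gt0 !inE.
have le_m : (cover_mon C <= m)%MM.
  apply/mnm_lepP=> z; rewrite mnmE; case: (boolP (_ \in C)) => // /(subsetP sC).
  by rewrite inE enum_valK.
rewrite -(submK le_m) mpolyXD scalerAl; apply: ideal_gen_mull.
by exists C; rewrite ?cover_monE.
Qed.

Lemma edge_prime_assoc x y : edge x y ->
  associated_prime J (fun g => ord_ge (edge_prime x y) 1 g).
Proof.
move=> hxy; split; first split.
- split; [exact: ord_ge0 | exact: ord_geD | exact: ord_ge_mull].
- by rewrite -mpolyX0 ord_geX /wt big1 // => z _; rewrite mnmE.
- move=> f g hfg; case: (boolP (ord_ge _ 1 f)) => hf; [by left | right].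
  exact: ord_ge_prime hf hfg.
(* The product of all vertices except x and y lies in every other edge prime but not in (x, y), so J
   : f0 is (x, y). *)
pose f0 : S := 'X_[cover_mon (~: [set x; y])].
have f0P : ~~ ord_ge (edge_prime x y) 1 f0.
  by rewrite ord_geX wt_edge // !mnmE !enum_rankK !inE !eqxx orbT.
exists f0 => g; split=> [hg|].
  apply/cover_idealP=> u v huv.
  have [huv'|] := boolP ((u \in [set x; y]) && (v \in [set x; y])).
    suff -> : edge_prime u v = edge_prime x y by rewrite mulrC ord_ge_mull.
    move: huv'; rewrite !inE => /andP[/orP[]/eqP eu /orP[]/eqP ev];
      by move: huv; rewrite eu ev /edge_prime ?edge_irrefl // setUC.
  move=> huv'; rewrite ord_ge_mull // ord_geX wt_edge // !mnmE !enum_rankK.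
  by rewrite !(in_setC _ [set _; _]) addn_gt0 !lt0b -negb_and.
move/cover_idealP/(_ x y hxy); rewrite mulrC; exact: ord_ge_prime.
Qed.

Lemma ideal_pow_ord s f x y : edge x y ->
  ideal_pow J s f -> ord_ge (edge_prime x y) s f.
Proof.
move=> hxy [t ht ->]; apply: ord_ge_sum => u /ht[w hw ->].
apply/ord_ge_mull/ord_ge_prod => i.
by have /cover_idealP := hw i; apply.
Qed.

Lemma symbolic_pow_ord s f x y : edge x y ->
  symbolic_pow J s f -> ord_ge (edge_prime x y) s f.
Proof.
move=> hxy /(_ _ (edge_prime_assoc hxy))[g /negP hg hgf].
exact/(ord_ge_prime hg)/ideal_pow_ord.
Qed.

(** As P = (J : f0) is proper, f0 lies outside some edge prime, which is prime and hence contains P.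
    Every element outside (x, y) is then a valid denominator at P. *)
Lemma associated_prime_sub P : associated_prime J P ->
  exists x y, edge x y /\ forall g, P g -> ord_ge (edge_prime x y) 1 g.
Proof.
case=> -[_ P1 _] [f0 hP].
have : ~~ [forall x, forall y, edge x y ==> ord_ge (edge_prime x y) 1 f0].
  apply/negP=> h; apply/P1/hP; rewrite mul1r; apply/cover_idealP=> x y hxy.
  by move/forallP/(_ x)/forallP/(_ y)/implyP: h; apply.
case/forallPn=> x /forallPn[y]; rewrite negb_imply => /andP[hxy hf0].
exists x, y; split=> // g /hP /cover_idealP/(_ x y hxy); rewrite mulrC.
exact: ord_ge_prime.
Qed.

End CoverIdealSymbolicPower.

(** * Complete multipartite graphs *)

Section MonomialDivision.
Variables (K : fieldType) (n : nat).
Local Notation S := {mpoly K[n]}.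

Lemma mpolyX_neq0 (m : 'X_{1..n}) : 'X_[m] != 0 :> S.
Proof.
apply/eqP=> /(congr1 (mcoeff m)) /eqP.
by rewrite mcoeffX eqxx mcoeff0 oner_eq0.
Qed.

Lemma mpolyX_factor (m1 m2 : 'X_{1..n}) : (m2 <= m1)%MM ->
  'X_[m1] = 'X_[m1 - m2] * 'X_[m2] :> S.
Proof. by move=> h; rewrite -mpolyXD submK. Qed.

Lemma mpolyX_dvd (f : S) (a : 'X_{1..n}) :
  (forall m, m \in msupp f -> (a <= m)%MM) -> exists g, f = g * 'X_[a].
Proof.
move=> h; exists (\sum_(m <- msupp f) f@_m *: 'X_[m - a]).
rewrite {1}[f]mpolyE big_distrl /= big_seq [RHS]big_seq.
by apply: eq_bigr => m hm; rewrite -scalerAl -mpolyX_factor ?h.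
Qed.

End MonomialDivision.

Section Multipartite.
Variables (k : nat) (p : k.-tuple nat).
Local Notation G := (complete_multipartite p).
Local Notation n := #|G|.

Definition part (z : 'I_n) : 'I_k := tag (enum_val z : multipartite_vertex p).

Definition part_mon (a : 'I_k -> nat) : 'X_{1..n} :=
  [multinom a (part z) | z < n].

Lemma part_mon_rank a (x : G) : part_mon a (enum_rank x) = a (tag x).
Proof. by rewrite mnmE /part enum_rankK. Qed.

Lemma part_monD a b :
  (part_mon a + part_mon b)%MM = part_mon (fun j => a j + b j)%N.
Proof. by apply/mnmP=> z; rewrite mnmDE !mnmE. Qed.

Lemma part_monMn a i : (part_mon a *+ i)%MM = part_mon (fun j => a j * i)%N.
Proof. by apply/mnmP=> z; rewrite mulmnE !mnmE. Qed.

Lemma eq_part_mon a b : a =1 b -> part_mon a = part_mon b.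
Proof. by move=> h; apply/mnmP=> z; rewrite !mnmE. Qed.

Lemma part_mon_le a b :
  (forall j, a j <= b j)%N -> (part_mon a <= part_mon b)%MM.
Proof. by move=> h; apply/mnm_lepP=> z; rewrite !mnmE. Qed.

Lemma sum_vertex (a : 'I_k -> nat) :
  (\sum_(x : G) a (tag x) = \sum_j a j * tnth p j)%N.
Proof.
have -> : (\sum_(x : G) a (tag x) = \sum_j \sum_(i < tnth p j) a j)%N.
  by rewrite sig_big_dep.
by apply: eq_bigr => j _; rewrite sum_nat_const card_ord mulnC.
Qed.

Lemma mdeg_part_mon a : mdeg (part_mon a) = (\sum_j a j * tnth p j)%N.
Proof.
rewrite mdegE -sum_vertex (reindex (@enum_rank G)) /=.
  by apply: eq_bigr => x _; rewrite part_mon_rank.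
exact/onW_bij/enum_rank_bij.
Qed.

Hypothesis hpos : forall i : 'I_k, (1 <= tnth p i)%N.

Definition part_vertex (i : 'I_k) : G :=
  Tagged (fun i => 'I_(tnth p i)) (Ordinal (hpos i)).

Lemma part_mon_neq0 a j : a j != 0%N -> part_mon a != 0%MM.
Proof.
apply: contraNneq => /mnmP/(_ (enum_rank (part_vertex j))).
by rewrite part_mon_rank mnmE /= => ->.
Qed.

(** * Minimal vertex covers and the degree of the cover ideal *)

Definition part_cover (i : 'I_k) : {set G} := [set x : G | tag x != i].

Lemma part_cover_min i : min_vertex_cover (part_cover i).
Proof.
apply/minsetP; split=> [|C /forallP hC sC].
  apply/forallP=> x; apply/forallP=> y; apply/implyP=> hxy; rewrite !inE.
  by case: eqP hxy => //= <-; rewrite eq_sym.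
apply/eqP; rewrite eqEsubset sC; apply/subsetP=> x; rewrite inE => hx.
have /forallP/(_ (part_vertex i))/implyP/(_ hx)/orP[//|/(subsetP sC)] := hC x.
by rewrite inE eqxx.
Qed.

Lemma min_cover_part (C : {set G}) : (0 < k)%N -> min_vertex_cover C ->
  exists i, C = part_cover i.
Proof.
move=> hk /minsetP[/forallP hC minC].
have [i hi] : exists i, part_cover i \subset C.
  (* A vertex x missed by C forces its neighbours, hence all other parts, into C; if C misses
     nothing, any part will do. *)
  have [x hx|hx] := pickP (mem (~: C)).
    exists (tag x); apply/subsetP=> y; rewrite inE eq_sym => hxy.
    have /forallP/(_ y)/implyP/(_ hxy) := hC x.
    by move: hx; rewrite /= in_setC => /negPf ->.
  exists (Ordinal hk); apply/subsetP=> y _.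
  by have := hx y; rewrite /= in_setC => /negbFE.
exists i; apply/esym/minC => //.
by have /minsetp := part_cover_min i.
Qed.

Lemma card_part_cover i : #|part_cover i| = (\sum_(j | j != i) tnth p j)%N.
Proof.
rewrite -sum1_card big_mkcond /=.
rewrite (eq_bigr (fun x : G => nat_of_bool (tag x != i))).
  rewrite (sum_vertex (fun j => nat_of_bool (j != i))) [RHS]big_mkcond.
  apply: eq_bigr => j _.
  by case: (j != i); rewrite ?mul1n.
by move=> x _; rewrite inE; case: ifP.
Qed.

Hypothesis hk : (2 <= k)%N.
Hypothesis hp : sorted geq p.

Definition min_part := last 0%N p.

Lemma min_part_tnth : exists i, tnth p i = min_part.
Proof.
have hk1 : (k.-1 < k)%N by case: k hk.
exists (Ordinal hk1); rewrite (tnth_nth 0%N) /= /min_part.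
by rewrite -[in RHS](nth_last 0%N) size_tuple.
Qed.

Lemma min_part_le i : (min_part <= tnth p i)%N.
Proof.
have tr : transitive geq by move=> a b c h1 h2; apply: leq_trans h2 h1.
rewrite (tnth_nth 0%N) /min_part -(nth_last 0%N) size_tuple.
apply: (sorted_leq_nth tr _ 0%N hp); rewrite ?inE ?size_tuple.
- exact: leqnn.
- exact: ltn_ord.
- by case: k hk.
by rewrite -ltnS; case: k i hk => // k' i _; apply: ltn_ord.
Qed.

Definition total := (\sum_j tnth p j)%N.

Lemma total_part i : total = (tnth p i + \sum_(j | j != i) tnth p j)%N.
Proof. by rewrite /total (bigD1 i). Qed.

Lemma min_part_le_others i : (min_part <= \sum_(j | j != i) tnth p j)%N.
Proof.
have [j hj] : exists j : 'I_k, j != i.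
  have h0 : (0 < k)%N by apply: ltnW.
  have [e|ne] := eqVneq i (Ordinal h0).
    by exists (Ordinal hk); rewrite e.
  by exists (Ordinal h0); rewrite eq_sym.
by rewrite (bigD1 j) //= (leq_trans (min_part_le j)) // leq_addr.
Qed.

(** Minimal covers are the complements of single parts, so a largest one omits a smallest part. *)
Lemma cover_ideal_deg_multipartite : cover_ideal_deg G = (total - min_part)%N.
Proof.
apply/eqP; rewrite eqn_leq; apply/andP; split.
  apply/bigmax_leqP=> C /(min_cover_part (ltnW hk))[i ->].
  by rewrite card_part_cover (total_part i); have := min_part_le i; lia.
have [i hi] := min_part_tnth; rewrite (total_part i) hi addKn -card_part_cover.
exact/leq_bigmax_cond/part_cover_min.
Qed.

(** * Generators and syzygies, with c half of s rounded up and e the parity of s *)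

Variables (K : fieldType) (s c e : nat).
Hypothesis hs : (s + e = 2 * c)%N.
Hypothesis he : (e <= 1)%N.
Hypothesis hc : (0 < c)%N.
Local Notation S := {mpoly K[n]}.
Local Notation N := (c * k)%N.
Local Notation J := (cover_ideal (G := G) (K := K)).

(* Generator 0 is the product of all vertices to the power c; the generator of
   index q + 1, where q = (l - 1) k + i, has exponent c - l on V_i and s - (c - l)
   on the other parts. For odd s generator 0 is redundant. *)
Definition gen_exp (r : nat) (j : 'I_k) : nat :=
  if r is q.+1 then
    (if j == q %% k :> nat then c - (q %/ k).+1 else c + (q %/ k).+1 - e)%N
  else c.

Definition syz_exp (q : nat) (j : 'I_k) : nat := (j == q %% k :> nat)%N.

(** Exponents of the parent's coefficient: the product of the vertices outside V_i. For q < k and s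
    odd it is 1, since the root is then the generator times the vertices of V_i. *)
Definition syz_coexp (q : nat) (j : 'I_k) : nat :=
  (if j == q %% k :> nat then 0 else 1 - (q < k) * e)%N.

Lemma level_le q : (q < N)%N -> (q %/ k < c)%N.
Proof. by rewrite ltn_divLR // ltnW. Qed.

Lemma syz_exp_rel q j : (q < N)%N ->
  (syz_exp q j + gen_exp q.+1 j = syz_coexp q j + gen_exp (q.+1 - k) j)%N.
Proof.
move=> hq; have hl := level_le hq; have k0 : (0 < k)%N by apply: ltnW.
rewrite /syz_exp /syz_coexp; case: ltnP => hqk.
  have -> : (q.+1 - k = 0)%N by apply/eqP; rewrite subn_eq0.
  by rewrite /= divn_small //; case: eqP => _; move: he hc; lia.
move: hl; rewrite -(subnK hqk); move: (q - k)%N => q'.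
rewrite -addSn addnK /= modnDr divnDr ?dvdnn // divnn k0 addn1.
by move: (q' %/ k)%N => d hd; case: eqP => _; move: hd he; lia.
Qed.

(** If one part is distinguished at level l, the sum is (c - l) + (c + l - e) = s; otherwise both
    exponents are at least c. *)
Lemma gen_exp_pair r (a b : 'I_k) :
  (r <= N)%N -> a != b -> (s <= gen_exp r a + gen_exp r b)%N.
Proof.
move=> hr hab; case: r hr => [|q] hr /=; first by move: hs; lia.
have := level_le hr; move: (q %/ k)%N => d hd.
have [ea|_] := eqVneq (a : nat) (q %% k)%N;
  have [eb|_] := eqVneq (b : nat) (q %% k)%N; try (move: hs he hc hd; lia).
by case/eqP: hab; apply: val_inj; rewrite /= ea eb.
Qed.

(** An earlier generator distinguished on V_i has a lower level; any other one has exponent at least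
    c there, while generator q+1 has less. Hence the colon ideals are principal. *)
Lemma gen_exp_colon q r (i : 'I_k) :
  (q < N)%N -> (r <= q)%N -> i = (q %% k)%N :> nat ->
  (gen_exp q.+1 i < gen_exp r i)%N.
Proof.
move=> hq hr hi; have hl := level_le hq; case: r hr => [|q'] hr /=.
  by rewrite hi eqxx ltn_subrL hc.
rewrite hi eqxx; case: eqP => [e'|_]; last first.
  by move: (q %/ k)%N (q' %/ k)%N hl he hc => d d'; lia.
suff : (q' %/ k < q %/ k)%N by move: (q %/ k)%N (q' %/ k)%N hl => d d'; lia.
rewrite ltn_neqAle leq_div2r 1?ltnW // andbT; apply: contraTneq hr => ed.
by rewrite (divn_eq q k) (divn_eq q' k) ed e' ltnn.
Qed.

Definition gen (r : 'I_N.+1) : S := 'X_[part_mon (gen_exp r)].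
Definition syz_coef (q : 'I_N) : S := 'X_[part_mon (syz_exp q)].
Definition syz_cocoef (q : 'I_N) : S := 'X_[part_mon (syz_coexp q)].
(** Going back k indices lowers the level by one on the same part; on the first level truncated
    subtraction gives the root 0. *)
Definition syz_par (q : 'I_N) : 'I_N.+1 := inord (q.+1 - k).

Lemma syz_parE q : syz_par q = (q.+1 - k)%N :> nat.
Proof. by rewrite inordK // ltnS (leq_trans (leq_subr _ _)). Qed.

Lemma syz_par_le q : (syz_par q <= q)%N.
Proof. by rewrite syz_parE; move: hk; lia. Qed.

Lemma syz_exp_gen (q : 'I_N) :
  (part_mon (syz_exp q) + part_mon (gen_exp q.+1)
   = part_mon (syz_coexp q) + part_mon (gen_exp (syz_par q)))%MM.
Proof.
rewrite !part_monD syz_parE; apply: eq_part_mon => j.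
exact: syz_exp_rel.
Qed.

Lemma syz_rel (q : 'I_N) :
  syz_coef q * gen (lift ord0 q) = syz_cocoef q * gen (syz_par q).
Proof. by rewrite /gen lift0 -!mpolyXD syz_exp_gen. Qed.

(** Orders in a single variable z of V_i are compared: earlier generators have a larger exponent at
    z than generator q+1, so z divides every monomial of f. *)
Lemma syz_colon (q : 'I_N) f (w : 'I_N.+1 -> S) :
  f * gen (lift ord0 q) = \sum_(r < N.+1 | (r <= q)%N) w r * gen r ->
  exists g, f = g * syz_coef q.
Proof.
move=> hf; apply: mpolyX_dvd => m hm; apply/mnm_lepP=> z; rewrite mnmE /syz_exp.
case: eqP => // hz.
have : ord_ge [set z] (gen_exp q.+1 (part z)).+1 (f * gen (lift ord0 q)).
  rewrite hf big_mkcond; apply: ord_ge_sum => r _; case: ifP => [hr|_].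
    by rewrite ord_ge_mull // ord_geX /wt big_set1 mnmE gen_exp_colon.
  exact: ord_ge0.
move/ord_geP/(_ (part_mon (gen_exp q.+1) + m)%MM).
rewrite /gen lift0 (perm_mem (msuppMX _ _)) map_f // => /(_ isT).
by rewrite /wt big_set1 mnmDE [part_mon _ z]mnmE -addn1 leq_add2l.
Qed.

Definition syz_diff : 'M[S]_(N, N.+1) := tree_diff syz_coef syz_cocoef syz_par.
Definition gen_aug : 'cV[S]_N.+1 := tree_aug gen.

Lemma syz_diff_exact (v : 'rV_N.+1) :
  v *m gen_aug = 0 <-> exists w, v = w *m syz_diff.
Proof.
apply: tree_exact.
- exact: mpolyX_neq0.
- exact: syz_par_le.
- exact: syz_rel.
- exact: syz_colon.
Qed.

Lemma syz_diff_inj (w : 'rV_N) : w *m syz_diff = 0 -> w = 0.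
Proof.
apply: tree_diff_inj => q; [exact: mpolyX_neq0 | exact: syz_par_le].
Qed.

Definition off_exp (i : 'I_k) (j : 'I_k) : nat := j != i.

Lemma off_mon_cover i : J 'X_[part_mon (off_exp i)].
Proof.
apply/cover_idealP=> x y hxy; rewrite ord_geX wt_edge // !part_mon_rank /off_exp.
rewrite addn_gt0 !lt0b -negb_and; apply: contraTN hxy => /andP[/eqP ex /eqP ey].
by rewrite /= /multipartite_edge ex ey eqxx.
Qed.

Lemma gen_symbolic f (v : 'rV_N.+1) :
  v *m gen_aug = f%:M -> symbolic_pow J s f.
Proof.
move=> hv P /associated_prime_sub[x [y [hxy hP]]].
(* g involves only parts away from x and y, so it lies outside (x, y), and it supplies exponent s on
   those parts. *)
pose g : S := 'X_[part_mon (fun j => ((j != tag x) && (j != tag y)) * s)%N].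
exists g.
  move/hP; rewrite ord_geX wt_edge // !part_mon_rank !eqxx andbF !mul0n.
  by [].
have -> : f = \sum_r v 0 r * gen r.
  move/rowP/(_ 0): hv; rewrite !mxE eqxx mulr1n => <-.
  by apply: eq_bigr => r _; rewrite mxE.
rewrite big_distrr; apply: ideal_gen_sum => r _ /=; rewrite mulrCA.
(* With i covers omitting the part of x and s - i omitting that of y, exponent i is needed at y and
   s - i at x; [gen_exp_pair] provides them. *)
apply: ideal_gen_mulr_closed; pose i := minn s (gen_exp r (tag y)).
have hi : (i <= s)%N by apply: geq_minl.
have := ideal_pow_expM (off_mon_cover (tag x)) (off_mon_cover (tag y)) hi.
rewrite !mpolyXn -mpolyXD !part_monMn part_monD => hpow.
rewrite /g /gen -mpolyXD part_monD (@mpolyX_factor _ _ _ (part_mon (fun j =>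
  off_exp (tag x) j * i + off_exp (tag y) j * (s - i))%N)).
  exact: ideal_gen_mulr_closed.
apply: part_mon_le => j; rewrite /off_exp.
have hpr := gen_exp_pair (leq_ord r) hxy.
have [->|hjx] := eqVneq j (tag x).
  rewrite (hxy : tag x != tag y) /= mul0n mul1n add0n mul0n add0n /i.
  by rewrite leq_subLR addn_minl leq_min leq_addr addnC.
have [->|hjy] := eqVneq j (tag y).
  by rewrite mul0n mul1n addn0 mul0n add0n geq_minr.
by rewrite /= !mul1n subnKC // leq_addr.
Qed.

(** If all exponents are at least c, the root divides. Otherwise a vertex x of minimal exponent a <
    c selects level c - a on its part: minimality settles that part, and the edge inequality gives
    at least s - a = c + (c - a) - e elsewhere. *)
Lemma gen_exp_dvd (m : 'X_{1..n}) :
  (forall x y : G, edge x y -> s <= m (enum_rank x) + m (enum_rank y))%N ->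
  exists r : 'I_N.+1, (part_mon (gen_exp r) <= m)%MM.
Proof.
move=> hm; have [h|] := boolP [forall x : G, c <= m (enum_rank x)]%N.
  exists ord0; apply/mnm_lepP=> z; rewrite mnmE -[z]enum_valK.
  exact: (forallP h).
case/forallPn=> x0; rewrite -ltnNge => hx0.
have [x _ xmin] := @arg_minnP G x0 xpredT (fun x => m (enum_rank x)) isT.
have {x0 hx0} hx : (m (enum_rank x) < c)%N.
  by apply: leq_ltn_trans (xmin x0 isT) hx0.
pose q := ((c - m (enum_rank x)).-1 * k + tag x)%N.
have k0 : (0 < k)%N by apply: ltnW.
have hqd : (q %/ k).+1 = (c - m (enum_rank x))%N.
  by rewrite divnMDl // divn_small ?ltn_ord // addn0 prednK // subn_gt0.
have hqm : (q %% k)%N = tag x by rewrite modnMDl modn_small ?ltn_ord.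
have hq : (q < N)%N by rewrite -ltn_divLR //; move: hx; lia.
exists (lift ord0 (Ordinal hq)); rewrite lift0; apply/mnm_lepP=> z.
rewrite mnmE /= hqd hqm -{2}[z]enum_valK.
case: eqP => [_|hz]; first by rewrite subKn ?xmin // ltnW.
have : edge x (enum_val z) by apply/eqP=> e'; apply: hz; rewrite e'.
move/hm; move: hx => /=.
have arith a b : (a < c -> s <= a + b -> c + (c - a) - e <= b)%N.
  by move: hs; lia.
exact: arith.
Qed.

Lemma gen_generates f : symbolic_pow J s f ->
  exists v : 'rV_N.+1, v *m gen_aug = f%:M.
Proof.
move=> hf; pose im g := exists v : 'rV_N.+1, v *m gen_aug = g%:M.
rewrite -[exists _, _]/(im f) [f]mpolyE big_seq.
elim/big_ind: _ => [|g h [v hv] [w hw]|m hm].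
- by exists 0; rewrite mul0mx raddf0.
- by exists (v + w); rewrite mulmxDl hv hw raddfD.
have [|r hr] := @gen_exp_dvd m.
  move=> x y hxy; have /ord_geP/(_ m hm) := symbolic_pow_ord hxy hf.
  by rewrite wt_edge.
exists (f@_m *: 'X_[m - part_mon (gen_exp r)] *: delta_mx 0 r).
rewrite -scalemxAl -rowE; apply/rowP=> j; rewrite ord1 !mxE eqxx mulr1n.
by rewrite -scalerAl -mpolyX_factor.
Qed.

(** * The graded free resolution *)

Definition multipartite_rank (i : nat) : nat :=
  match i with 0 => N.+1 | 1 => N | _ => 0 end.

Definition gen_deg (r : nat) : nat := mdeg (part_mon (gen_exp r)).
Definition syz_deg (q : nat) : nat :=
  (mdeg (part_mon (syz_exp q)) + gen_deg q.+1)%N.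

Definition multipartite_shift (i : nat) : 'I_(multipartite_rank i) -> int :=
  match i with
  | 0 => fun r => (gen_deg r)%:Z
  | 1 => fun q => (syz_deg q)%:Z
  | _ => fun=> 0
  end.

Definition multipartite_diff (i : nat) :
    'M[S]_(multipartite_rank i.+1, multipartite_rank i) :=
  match i with 0 => syz_diff | _ => 0 end.

Definition multipartite_complex : graded_free K n :=
  @GradedFree K n multipartite_rank multipartite_shift multipartite_diff
    gen_aug.

Lemma multipartite_resolution :
  graded_free_resolution multipartite_complex (symbolic_pow J s).
Proof.
split=> [[|i] q r|r|f|v|[|i] v].
- rewrite /= mxE; apply: homogD.
    case: eqP => [->|_]; last exact: homog0.
    by rewrite mulr1n /syz_deg PoszD addrK; apply: homogX.
  apply: homogN; case: eqP => [->|_]; last exact: homog0.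
  rewrite mulr1n /syz_deg /gen_deg -mdegD syz_exp_gen mdegD PoszD addrK.
  exact: homogX.
- by rewrite mxE; apply: homog0.
- by rewrite mxE; apply: homogX.
- by split=> [/gen_generates //|[v /gen_symbolic]].
- exact: syz_diff_exact.
- split=> [/syz_diff_inj ->|[w ->]]; first by exists 0; rewrite mul0mx.
  by rewrite mulmx0 mul0mx.
- split=> _; last by rewrite mulmx0.
  by exists 0; apply/rowP; case: i v => [|i] v [].
Qed.

(** Parts are nonempty, so [syz_coef q] is never constant; modulo the variables only a constant
    [syz_cocoef q] survives. *)
Lemma tens_multipartite_diff (q : 'I_N) :
  row q (tens_diff multipartite_complex 0)
  = - ((part_mon (syz_coexp q) == 0%MM)%:R *: delta_mx 0 (syz_par q)).
Proof.
apply/rowP=> r; rewrite !mxE raddfB /= !raddfMn /= !mcoeffX.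
have /negPf -> : part_mon (syz_exp q) != 0%MM.
  have hq : (q %% k < k)%N by rewrite ltn_mod; apply: ltnW.
  by apply: (@part_mon_neq0 _ (Ordinal hq)); rewrite /syz_exp /= eqxx.
by rewrite mulr0n mul0rn add0r mulNrn mulr_natr.
Qed.

(** * Degrees of the generators and syzygies *)

Lemma gen_degE q (i : 'I_k) : i = (q %% k)%N :> nat -> gen_deg q.+1
  = ((c - (q %/ k).+1) * tnth p i
     + (c + (q %/ k).+1 - e) * \sum_(j | j != i) tnth p j)%N.
Proof.
move=> hi; rewrite /gen_deg mdeg_part_mon (bigD1 i) //= hi eqxx; congr addn.
rewrite big_distrr; apply: eq_bigr => j hj /=.
by rewrite -hi (inj_eq val_inj) (negPf hj).
Qed.

Lemma syz_degE q (i : 'I_k) : i = (q %% k)%N :> nat ->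
  syz_deg q = (tnth p i + gen_deg q.+1)%N.
Proof.
move=> hi; rewrite /syz_deg mdeg_part_mon (bigD1 i) //= /syz_exp hi eqxx mul1n.
rewrite big1 ?addn0 // => j hj.
by rewrite -hi (inj_eq val_inj) (negPf hj).
Qed.

Lemma gen_deg0 : gen_deg 0 = (c * total)%N.
Proof. by rewrite /gen_deg mdeg_part_mon -big_distrr. Qed.

Lemma gen_deg_le q : (q < N)%N -> (gen_deg q.+1 <= s * (total - min_part))%N.
Proof.
move=> hq; have hl := level_le hq; have k0 : (0 < k)%N by apply: ltnW.
have hi : (q %% k < k)%N by rewrite ltn_mod.
rewrite (@gen_degE q (Ordinal hi)) //.
have := total_part (Ordinal hi); have := min_part_le (Ordinal hi).
have := min_part_le_others (Ordinal hi).
move: (\sum_(j | _) _)%N (tnth p _) total min_part (q %/ k)%N hl.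
move=> Q pi P pk l hl h1 h2 h3.
have -> : s = ((c - l.+1) + (c + l.+1 - e))%N by move: hs he hl; lia.
by rewrite mulnDl leq_add // leq_mul //; lia.
Qed.

Lemma syz_deg_le q : (q < N)%N ->
  (syz_deg q <= s * (total - min_part) + min_part)%N.
Proof.
move=> hq; have hl := level_le hq; have k0 : (0 < k)%N by apply: ltnW.
have hi : (q %% k < k)%N by rewrite ltn_mod.
rewrite (@syz_degE q (Ordinal hi)) // (@gen_degE q (Ordinal hi)) //.
have := total_part (Ordinal hi); have := min_part_le (Ordinal hi).
have := min_part_le_others (Ordinal hi).
move: (\sum_(j | _) _)%N (tnth p _) total min_part (q %/ k)%N hl.
move=> Q pi P pk l hl h1 h2 h3.
(* One copy of Q is split off: with the [pi] added by the syzygy it makes P, which is (P - pk) +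
   pk. *)
have -> : s = ((c - l.+1) + (c + l - e)).+1 by move: hs he hl; lia.
have -> : (c + l.+1 - e = (c + l - e).+1)%N by move: hs he hl; lia.
have hP : ((c - l.+1) * pi <= (c - l.+1) * (P - pk))%N.
  by rewrite leq_mul //; lia.
have hQ : ((c + l - e) * Q <= (c + l - e) * (P - pk))%N.
  by rewrite leq_mul //; lia.
rewrite !mulSn mulnDl; lia.
Qed.

(** At level c on a smallest part the exponents are 0 and s, so adding p_k to the generator's degree
    attains the bound. *)
Lemma last_syz : exists q : 'I_N,
  syz_deg q = (s * (total - min_part) + min_part)%N /\
  ((1 < s)%N -> part_mon (syz_coexp q) != 0%MM).
Proof.
have k0 : (0 < k)%N by apply: ltnW.
have [i hi] := min_part_tnth.
have hq : (c.-1 * k + i < N)%N.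
  by rewrite -{2}(prednK hc) mulSn addnC ltn_add2r.
have hd : ((c.-1 * k + i) %/ k = c.-1)%N.
  by rewrite divnMDl // divn_small ?ltn_ord // addn0.
have hm : ((c.-1 * k + i) %% k = i)%N by rewrite modnMDl modn_small ?ltn_ord.
exists (Ordinal hq); split.
  rewrite /= (@syz_degE _ i) ?hm // (@gen_degE _ i) ?hm // hd prednK // subnn.
  rewrite (total_part i) hi addKn mul0n add0n addnC; congr (_ * _ + _)%N.
  by move: hs; lia.
move=> s1; have [j hj] : exists j : 'I_k, j != i.
  have [->|ne] := eqVneq i (Ordinal k0); first by exists (Ordinal hk).
  by exists (Ordinal k0); rewrite eq_sym.
apply: (@part_mon_neq0 _ j); rewrite /syz_coexp /= hm (inj_eq val_inj) (negPf hj).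
case: ltnP => h; last by rewrite mul0n.
(* This index lies on the first level only if c = 1; then s > 1 means s = 2 and e = 0. *)
have c1 : (c = 1)%N.
  have : (c.-1 * k < 1 * k)%N by rewrite mul1n (leq_ltn_trans (leq_addr _ _) h).
  by rewrite ltn_pmul2r // ltnS leqn0 => /eqP c0; rewrite -(prednK hc) c0.
by move: hs s1; rewrite c1; lia.
Qed.

Lemma unit_syz (q : 'I_N) : e = 1%N -> (q < k)%N ->
  syz_deg q = gen_deg 0 /\
  row q (tens_diff multipartite_complex 0) = - delta_mx 0 ord0.
Proof.
move=> e1 hq; have h0 : part_mon (syz_coexp q) = 0%MM.
  by apply/mnmP=> z; rewrite !mnmE /syz_coexp hq e1 if_same.
have hpar : syz_par q = ord0.
  by apply: val_inj; rewrite /= syz_parE; apply/eqP; rewrite subn_eq0.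
split; last by rewrite tens_multipartite_diff h0 eqxx scale1r hpar.
by rewrite /syz_deg /gen_deg -mdegD syz_exp_gen h0 hpar add0m.
Qed.

(** * Tor and the regularity *)

Lemma multipartite_Tor1 : Tor_neq0 (symbolic_pow J s) 1
  (s * (total - min_part) + min_part)%N%:Z.
Proof.
exists multipartite_complex; first exact: multipartite_resolution.
(* The module in homological degree 2 is zero, so a boundary in degree 1 vanishes. *)
have nb j (v : 'rV[K]_(grank multipartite_complex 1)) :
    v != 0 -> ~ @tens_boundary K n multipartite_complex 1 j v.
  move=> v0 [w _ hw]; case/eqP: v0; rewrite hw.
  by rewrite /tens_diff /= raddf0 mulmx0.
have [q [hq hq1]] := last_syz.
have [s1|s1] := ltnP 1 s.
  exists (delta_mx 0 q); split.
  - by move=> r; rewrite mxE eqxx -hq; have [-> //|_] := eqVneq r q; rewrite eqxx.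
  - by rewrite /= -rowE tens_multipartite_diff (negPf (hq1 s1)) scale0r oppr0.
  apply: nb; apply/eqP=> /rowP/(_ q) /eqP.
  by rewrite !mxE !eqxx oner_eq0.
have [c1 e1] : c = 1%N /\ e = 1%N by move: hs he hc s1; lia.
have kN : (k <= N)%N by rewrite leq_pmull.
(* For s = 1 every syzygy reduces to minus the root modulo the variables; the difference of two of
   them, available as k >= 2, is a cycle. *)
pose q0 : 'I_N := Ordinal (leq_trans (ltnW hk) kN).
pose q1 : 'I_N := Ordinal (leq_trans hk kN).
have [d0 r0] := @unit_syz q0 e1 (ltnW hk); have [d1 r1] := @unit_syz q1 e1 hk.
have hd : gen_deg 0 = (s * (total - min_part) + min_part)%N.
  have [i _] := min_part_tnth; have := total_part i; have := min_part_le i.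
  have -> : s = 1%N by move: hs; rewrite c1 e1; lia.
  by rewrite gen_deg0 c1; lia.
exists (delta_mx 0 q0 - delta_mx 0 q1); split.
- move=> r; rewrite !mxE eqxx -hd /=.
  have [-> _|_] := eqVneq r q0; first by rewrite d0.
  have [-> _|_] := eqVneq r q1; first by rewrite d1.
  by rewrite subr0 eqxx.
- by rewrite /= mulmxBl -!rowE r0 r1 subrr.
apply: nb; apply/eqP=> /rowP/(_ q0) /eqP.
by rewrite !mxE !eqxx subr0 oner_eq0.
Qed.

Lemma min_part_gt0 : (0 < min_part)%N.
Proof. by have [i <-] := min_part_tnth. Qed.

Lemma multipartite_Tor_le i j : Tor_neq0 (symbolic_pow J s) i j ->
  j - i%:Z <= (s * (total - min_part) + min_part)%N%:Z - 1.
Proof.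
move/(Tor_neq0_resolution multipartite_resolution)=> [v [dv _ nb]].
have [a ha] : exists a, v 0 a != 0.
  apply/existsP; apply: contra_notT nb => /existsPn h.
  exists 0; first by move=> a; rewrite mxE eqxx.
  by rewrite mul0mx; apply/rowP=> a; rewrite mxE; apply/eqP/negPn/h.
have ja := dv a ha.
case: i v dv nb a ha ja => [|[|i]] /= v dv nb a ha ja; last by case: a ha {ja}.
  have hb := min_part_gt0.
  (* Either v involves a generator other than the root, whose degree bounds j, or v is a multiple of
     the root. *)
  have [q hq|h] := pickP (fun q : 'I_N => v 0 (lift ord0 q) != 0).
    have := gen_deg_le (ltn_ord q).
    by have /= <- := dv _ hq; rewrite -[bump 0 q]/q.+1; lia.
  have ev : v = v 0 ord0 *: delta_mx 0 ord0.
    apply/rowP=> r; rewrite !mxE eqxx /=; case: (unliftP ord0 r) => [q ->|->].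
      by rewrite mulr0; apply/eqP; rewrite -[_ == _]negbK h.
    by rewrite mulr1.
  have v0 : v 0 ord0 != 0.
    by apply: contraNneq ha => v0; rewrite ev v0 scale0r mxE.
  have := dv _ v0 => /= ej; move: he.
  rewrite leq_eqVlt ltnS leqn0 => /orP[]/eqP e01.
    have N0 : (0 < N)%N by rewrite muln_gt0 hc ltnW.
    have [d0 r0] := @unit_syz (Ordinal N0) e01 (ltnW hk).
    (* for odd s the root is redundant, hence a boundary *)
    case: nb; exists (- v 0 ord0 *: delta_mx 0 (Ordinal N0)).
      move=> r; rewrite !mxE eqxx /=; have [-> _|_] := eqVneq r (Ordinal N0).
        by rewrite d0.
      by rewrite mulr0 eqxx.
    by rewrite -scalemxAl -rowE r0 scaleNr scalerN opprK.
  have [i0 _] := min_part_tnth; have hP := total_part i0.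
  have hQ := min_part_le_others i0; have hi := min_part_le i0.
  have : (gen_deg 0 <= s * (total - min_part))%N.
    (* For s = 2c the bound reduces to total <= 2 (total - min_part): the parts other than a given
       one have at least [min_part] vertices in all. *)
    rewrite gen_deg0; have -> : s = (c * 2)%N by move: hs; rewrite e01; lia.
    by rewrite -mulnA leq_mul //; lia.
  by move: ej; lia.
by have := syz_deg_le (ltn_ord a); lia.
Qed.

End Multipartite.

Theorem theorem4p6 (K : fieldType) (k : nat) (p : k.-tuple nat)
    (hk : (2 <= k)%N) (hp : sorted geq p)
    (hpos : forall i : 'I_k, (1 <= tnth p i)%N)
    (s : nat) (hs : (1 <= s)%N) :
  has_reg (symbolic_pow (cover_ideal (G := complete_multipartite p) (K := K)) s)
    (s%:Z * (cover_ideal_deg (complete_multipartite p))%:Z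
       + (last 0%N p)%:Z - 1).
Proof.
have hsc : (s + odd s = 2 * uphalf s)%N.
  by rewrite -{1}(odd_double_half s) uphalf_half -muln2; case: (odd s); lia.
have hc : (0 < uphalf s)%N by case: s hs {hsc}.
rewrite (cover_ideal_deg_multipartite hpos hk hp) -PoszM -PoszD.
split; last by move=> i j; apply: (multipartite_Tor_le hpos hk hp hsc (leq_b1 _) hc).
exists 1%N; eexists; split; last by reflexivity.
exact: (multipartite_Tor1 hpos hk hp K hsc (leq_b1 _) hc).
Qed.
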